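(* Let $M$ be a finite left regular band with minimal ideal $\widehat 0$ and $P$ an adapted probability on $M$. Let $\tau$ be the absorption time into $\widehat 0$ of the right random walk on $M$ driven by $P$ started at $1$. Then $$E[\tau]=-\sum_{X>\widehat 0}\frac{1}{1-\lambda_X}\,\mu(\widehat 0,X),$$ the sum running over $X\in\Lambda(M)$, $X\neq\widehat 0$.
   Context: A left regular band is a monoid with $x^2=x$, $xyx=xy$. $\Lambda(M)=\{Me:e^2=e\}$ ordered by inclusion with least element $\widehat 0$ and Möbius function $\mu$. For $m\in M$, $c(m)=Mm$ (since $m$ is idempotent), and $\lambda_X=\sum_{m\in M,\ c(m)\ge X}P(m)$. $P$ is adapted if the submonoid generated by its support contains $\widehat 0$. The right random walk on $M$ driven by $P$ has state set $M$ and from state $m$ moves to $mx$ with probability $P(x)$ (summed over $x$); $\tau$ is the first time the walk, started at $1$, lies in $\widehat 0$. *)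

(* Defs.v *)
From HB Require Import structures.
From mathcomp Require Import all_boot all_order all_algebra.
From mathcomp Require Import all_classical all_reals all_analysis.

Set Implicit Arguments.
Unset Strict Implicit.
Unset Printing Implicit Defensive.

Import Order.TTheory GRing.Theory Num.Theory.

HB.mixin Record isLeftRegularBand (M : Type) of Monoid M := {
  lrb_idem : forall x : M, (x * x = x)%g ;
  lrb_xyx : forall x y : M, (x * y * x = x * y)%g
}.

#[short(type="finLRBType")]
HB.structure Definition FinLRB :=
  {M of isLeftRegularBand M & Monoid M & Finite M}.

Section Algebra.
Variable M : finLRBType.
Implicit Types (x y e m : M) (A S I : {set M}).
Local Open Scope group_scope.

Definition left_ideal_gen m : {set M} := [set x * m | x : M]%SET.

Definition principal_left_ideals : {set {set M}} :=
  [set left_ideal_gen e | e : M & e * e == e]%SET.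

Definition is_ideal I : bool :=
  (I != finset.set0) &&
  [forall x, forall y, (y \in I) ==> (x * y \in I) && (y * x \in I)].

Definition minimal_ideal : {set M} := (\bigcap_(I | is_ideal I) I)%SET.

Definition is_submonoid S : bool :=
  (1 \in S) && [forall x in S, forall y in S, x * y \in S].

Definition submonoid_gen A : {set M} :=
  (\bigcap_(S | is_submonoid S && (A \subset S)) S)%SET.

Lemma left_ideal_gen_ideal e : is_ideal (left_ideal_gen e).
Proof.
apply/andP; split; first by apply/set0Pn; exists (1 * e); exact: imset_f.
apply/forallP => x; apply/forallP => y; apply/implyP => /imsetP[a _ ->].
apply/andP; split; apply/imsetP; first by exists (x * a); rewrite ?mulgA.
by exists (a * e * x); rewrite // -!mulgA (mulgA e x e) lrb_xyx.
Qed.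

Lemma left_ideal_gen_in m : left_ideal_gen m \in principal_left_ideals.
Proof. by apply/imsetP; exists m => //; rewrite inE lrb_idem eqxx. Qed.

Lemma minimal_ideal_in : minimal_ideal \in principal_left_ideals.
Proof.
pose e : M := \prod_(m <- enum M) m.
have eM m : e * m = e.
  rewrite /e; have: m \in enum M by rewrite mem_enum.
  elim: (enum M) => // a s IH; rewrite inE big_cons => /orP[/eqP->|/IH H].
    exact: lrb_xyx.
  by rewrite -mulgA H.
suff -> : minimal_ideal = left_ideal_gen e by exact: left_ideal_gen_in.
apply/eqP; rewrite finset.eqEsubset; apply/andP; split.
  by apply: finset.bigcap_inf; exact: left_ideal_gen_ideal.
apply/finset.bigcapsP => I /andP[/set0Pn[i iI] /forallP H].
have eI : e \in I.
  by move: (H e) => /forallP/(_ i); rewrite iI eM => /andP[].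
apply/fintype.subsetP => _ /imsetP[a _ ->].
by move: (H a) => /forallP/(_ e); rewrite eI => /andP[].
Qed.

Lemma minimal_ideal_ideal : is_ideal minimal_ideal.
Proof.
by have /imsetP[e _ ->] := minimal_ideal_in; exact: left_ideal_gen_ideal.
Qed.

End Algebra.

Record Lambda (M : finLRBType) := MkLambda {
  Lambda_set :> {set M} ;
  Lambda_setP : Lambda_set \in principal_left_ideals M
}.

HB.instance Definition _ (M : finLRBType) := [isSub for @Lambda_set M].
HB.instance Definition _ (M : finLRBType) := [Finite of Lambda M by <:].

Fact Lambda_display : Order.disp_t. Proof. exact: Order.Disp tt tt. Qed.

Section LambdaOrder.
Variable M : finLRBType.
Implicit Types X Y Z : Lambda M.

Definition Lambda_le X Y : bool := Lambda_set X \subset Lambda_set Y.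

Lemma Lambda_le_refl : reflexive Lambda_le.
Proof. by move=> X; exact: subxx. Qed.

Lemma Lambda_le_anti : antisymmetric Lambda_le.
Proof.
by move=> X Y H; apply/val_inj/eqP; rewrite finset.eqEsubset.
Qed.

Lemma Lambda_le_trans : transitive Lambda_le.
Proof. by move=> Y X Z; exact: fintype.subset_trans. Qed.

HB.instance Definition _ := Order.Le_isPOrder.Build Lambda_display (Lambda M)
  Lambda_le_refl Lambda_le_anti Lambda_le_trans.

Lemma Lambda_min X : (MkLambda (minimal_ideal_in M) <= X)%O.
Proof.
apply: finset.bigcap_inf; case: X => /= _ /imsetP[e _ ->].
exact: left_ideal_gen_ideal.
Qed.

HB.instance Definition _ :=
  Order.hasBottom.Build Lambda_display (Lambda M) Lambda_min.

Lemma Lambda_leE X Y : (X <= Y)%O = (Lambda_set X \subset Lambda_set Y).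
Proof. by []. Qed.

Lemma Lambda_botE : Lambda_set (\bot : Lambda M)%O = minimal_ideal M.
Proof. by []. Qed.

Definition content (m : M) : Lambda M := MkLambda (left_ideal_gen_in m).

End LambdaOrder.

Section Mobius.
Context {d : Order.disp_t} {T : finPOrderType d}.
Implicit Types x y z : T.
Local Open Scope ring_scope.

(* [n] is recursion fuel; [mobiusxx], [mobius_lt] and [mobius_nle] below are
   the defining equations *)
Fixpoint mobius_rec (n : nat) x y : int :=
  if n is n'.+1 then
    if x == y then 1
    else if (x < y)%O then
      - \sum_(z : T | (x <= z)%O && (z < y)%O) mobius_rec n' x z
    else 0
  else 0.

Definition mobius x y : int := mobius_rec #|T| x y.

Lemma mobius_rec_fuel n n' x y :
  (#|[set z | (z <= y)%O]%SET| <= n)%N -> (#|[set z | (z <= y)%O]%SET| <= n')%N ->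
  mobius_rec n x y = mobius_rec n' x y.
Proof.
have pos (u : T) : (0 < #|[set z : T | (z <= u)%O]%SET|)%N.
  by apply/card_gt0P; exists u; rewrite inE.
elim: n n' y => [|n IH] [|n'] y.
- by [].
- by move=> /(leq_trans (pos y)).
- by move=> _ /(leq_trans (pos y)).
move=> Hn Hn' /=; case: eqP => // _; case: ifP => // _; congr (- _).
apply: eq_bigr => z /andP[_ zy].
have lt : (#|[set t | (t <= z)%O]%SET| < #|[set t | (t <= y)%O]%SET|)%N.
  apply: proper_card; apply/properP; split.
    by apply/fintype.subsetP => t; rewrite !inE => /le_lt_trans/(_ zy)/ltW.
  by exists y; rewrite !inE // -?ltNge // (lt_geF zy).
by apply: IH; rewrite -ltnS; exact: leq_trans lt _.
Qed.

Lemma mobiusxx x : mobius x x = 1.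
Proof.
rewrite /mobius; case E: #|T| => [|n] /=; last by rewrite eqxx.
by have /card0_eq/(_ x) := E.
Qed.

Lemma mobius_lt x y : (x < y)%O ->
  mobius x y = - \sum_(z : T | (x <= z)%O && (z < y)%O) mobius x z.
Proof.
move=> xy; rewrite [LHS](@mobius_rec_fuel _ #|T|.+1).
- by rewrite /= (lt_eqF xy) xy.
- exact: max_card.
- exact/leqW/max_card.
Qed.

Lemma mobius_nle x y : ~~ (x <= y)%O -> mobius x y = 0.
Proof.
move=> xy; rewrite /mobius; case: #|T| => //= n.
case: eqP xy => [->|_]; first by rewrite lexx.
by case: ifP => // /ltW ->.
Qed.

End Mobius.

Section Walk.
Context {R : realType} {M : finLRBType}.
Implicit Types (P : M -> R).
Local Open Scope ring_scope.

Definition is_probability P : Prop :=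
  (forall m, 0 <= P m) /\ \sum_(m : M) P m = 1.

Definition adapted P : Prop :=
  minimal_ideal M \subset submonoid_gen [set m | P m != 0]%SET.

Definition lambda P (X : Lambda M) : R := \sum_(m : M | (X <= content m)%O) P m.

Definition transition P (m m' : M) : R := \sum_(x : M | (m * x)%g == m') P x.

Local Open Scope classical_set_scope.

(* The [step] clause is the Markov property with transition matrix
   [transition P], multiplied out so that histories of probability zero need
   no side condition. *)
Record right_random_walk (d : measure_display) (T : measurableType d)
    (Pr : probability T R) (P : M -> R) (W : nat -> T -> M) : Prop := {
  walk_measurable : forall n m, measurable [set w | W n w = m] ;
  walk_init : Pr [set w | W 0%N w = 1%g] = 1%E ;
  walk_step : forall (n : nat) (x : nat -> M),
    Pr [set w | forall k, (k <= n.+1)%N -> W k w = x k] =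
    (Pr [set w | forall k, (k <= n)%N -> W k w = x k] *
     (transition P (x n) (x n.+1))%:E)%E
}.

(* valued in [\bar R]: [+oo] on trajectories that are never absorbed *)
Definition absorption_time (T : Type) (W : nat -> T -> M) (w : T) : \bar R :=
  ereal_inf [set (n%:R)%:E | n in [set n : nat | W n w \in minimal_ideal M]].

End Walk.

(* Main.v *)
(* The content [m |-> Mm] turns products into meets, so the walk [W n] has
   content above [X] exactly when all its [n] increments do, which happens with
   probability [lambda_X ^ n].  Moebius inversion over [Lambda M] then gives
   [Pr (W n \notin 0^) = - \sum_(X > 0^) mu(0^, X) lambda_X ^ n].  Since the walk
   cannot leave the ideal [0^], this is [Pr (tau > n)]; summing over [n] gives
   the expectation, the geometric series converging because adaptedness forces
   [lambda_X < 1] for [X > 0^]. *)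
From Pilot Require Import Defs.
From mathcomp Require Import all_boot all_order all_algebra.
From mathcomp Require Import all_classical all_reals all_analysis.
From mathcomp Require Import measurable_realfun.
(* Imported again because MathComp-Analysis also has a [content]. *)
Import Pilot.Defs.

Set Implicit Arguments.
Unset Strict Implicit.
Unset Printing Implicit Defensive.

Import Order.TTheory GRing.Theory Num.Theory numFieldNormedType.Exports.

Local Open Scope ring_scope.

(** The recursion [mobius_lt] makes the top term [z = y] cancel all the others as soon as
    [x < y]. *)
Lemma sum_mobius_ge (d : Order.disp_t) (T : finPOrderType d) (x y : T) :
  (x <= y)%O ->
  \sum_(z : T | (x <= z)%O && (z <= y)%O) mobius x z = (x == y)%:R.
Proof.
move=> xy; rewrite (bigD1 y) /=; last by rewrite xy lexx.
rewrite (eq_bigl (fun z => (x <= z)%O && (z < y)%O)) => [|z]; last first.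
  by rewrite -andbA [in RHS]lt_neqAle [(z != y) && _]andbC.
case: eqVneq => [<-|nxy].
  by rewrite mobiusxx big1 ?addr0// => z /andP[/le_lt_trans h /h]; rewrite ltxx.
by rewrite mobius_lt ?addNr// lt_neqAle nxy.
Qed.

(** * Contents and the order on left ideals *)

Section Content.
Variable M : finLRBType.
Implicit Types (x y m : M) (X Y : Lambda M).

(** Right multiplication by the idempotent [m] is a projection onto its left ideal, whose elements
    are thus its fixed points. *)
Lemma mem_left_ideal_gen x m : (x \in left_ideal_gen m) = (x * m == x)%g.
Proof.
apply/imsetP/eqP => [[y _ ->]|xm]; last by exists x.
by rewrite -mulgA lrb_idem.
Qed.

Lemma le_content X m : (X <= content m)%O = (X \subset left_ideal_gen m).
Proof. by []. Qed.

(** The left ideal of a product is the intersection of the two left ideals: if [z * x * y = z], then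
    [z * x = z * x * y * x = z * x * y = z] by [lrb_xyx], and [z * y = z] by idempotence of [y]. *)
Lemma le_contentM X x y :
  (X <= content (x * y)%g)%O = (X <= content x)%O && (X <= content y)%O.
Proof.
rewrite !le_content -finset.subsetI.
suff -> : left_ideal_gen (x * y)%g = (left_ideal_gen x :&: left_ideal_gen y)%SET.
  by [].
apply/finset.setP => z; rewrite finset.in_setI !mem_left_ideal_gen.
apply/eqP/andP => [zxy|[/eqP zx /eqP zy]]; last by rewrite mulgA zx zy.
by split; apply/eqP; rewrite -[in LHS]zxy -!mulgA ?(mulgA x y x) ?lrb_xyx
  ?lrb_idem.
Qed.

Lemma le_content1 X : (X <= content 1%g)%O.
Proof.
by rewrite le_content; apply/fintype.subsetP => z _; rewrite mem_left_ideal_gen mulg1.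
Qed.

Lemma mem_minimal_ideal m :
  (m \in minimal_ideal M) = (content m == \bot%O).
Proof.
apply/idP/eqP => [mI|mbot]; last first.
  have <- : Lambda_set (content m) = minimal_ideal M by rewrite mbot.
  by rewrite mem_left_ideal_gen lrb_idem.
apply/le_anti; rewrite le0x andbT Lambda_leE Lambda_botE.
have /andP[_ /forallP H] := minimal_ideal_ideal M.
apply/fintype.subsetP => _ /imsetP[a _ ->].
by have /forallP/(_ m) := H a; rewrite mI => /andP[].
Qed.

Lemma minimal_idealMr m x : m \in minimal_ideal M -> (m * x)%g \in minimal_ideal M.
Proof.
have /andP[_ /forallP/(_ x)/forallP/(_ m)] := minimal_ideal_ideal M.
by move=> /implyP h /h/andP[].
Qed.

End Content.

(** * The numbers [lambda P X] as eigenvalues of the transition matrix *)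

Section Eigenvalues.
Context {R : realType} {M : finLRBType}.
Variables (P : M -> R) (HP : is_probability P).
Implicit Types (X : Lambda M).

Lemma lambda_ge0 X : 0 <= lambda P X.
Proof. by apply: sumr_ge0 => m _; case: HP. Qed.

Lemma lambda_bot : lambda P \bot%O = 1.
Proof. by case: HP => _ <-; apply: eq_bigl => m; rewrite le0x. Qed.

(** The elements of content above [X] form a submonoid. If it contained the support of [P],
    adaptedness would put the minimal ideal in it and force [X] down to the bottom; so some [m] of
    positive mass is missing from [lambda P X]. *)
Lemma lambda_lt1 X : adapted P -> (\bot < X)%O -> lambda P X < 1.
Proof.
case: HP => P0 P1 HPa X0.
have [m nXm Pm] : exists2 m, ~~ (X <= content m)%O & P m != 0.
  pose S := [set m : M | X <= content m]%SET%O.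
  have Ssub : is_submonoid S.
    rewrite /is_submonoid inE le_content1; apply/'forall_implyP => x xS.
    apply/'forall_implyP => y; move: xS; rewrite !inE le_contentM => -> //.
  case: (boolP ([set m | P m != 0]%SET \subset S)); last first.
    by case/subsetPn => m; rewrite !inE => ? ?; exists m.
  move=> PS; have [e _ eE] := imsetP (minimal_ideal_in M).
  have /fintype.subsetP genS : submonoid_gen [set m | P m != 0]%SET \subset S.
    by apply: finset.bigcap_inf; rewrite Ssub.
  have : e \in S.
    by apply/genS/(fintype.subsetP HPa); rewrite eE mem_left_ideal_gen lrb_idem.
  rewrite inE => /(lt_le_trans X0).
  suff -> : content e = \bot%O by rewrite ltxx.
  by apply/eqP; rewrite -mem_minimal_ideal eE mem_left_ideal_gen lrb_idem.
rewrite -P1 (bigID (fun m => (X <= content m)%O)) /= ltrDl (bigD1 m)//=.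
by rewrite ltr_pwDl ?sumr_ge0// lt0r Pm P0.
Qed.

Lemma transition_minimal_ideal m m' :
  m \in minimal_ideal M -> m' \notin minimal_ideal M -> transition P m m' = 0.
Proof.
move=> mI m'I; apply: big_pred0 => x; apply: contraNF m'I => /eqP <-.
exact: minimal_idealMr.
Qed.

(** The indicator of the contents above [X] is an eigenfunction of the transition matrix, with
    eigenvalue [lambda P X]; this rests on [le_contentM]. *)
Lemma sum_transition_ge X m :
  \sum_(m' | (X <= content m')%O) transition P m m' =
  (X <= content m)%O%:R * lambda P X.
Proof.
rewrite (exchange_big_dep xpredT)//= mulr_natl -sumrMnl big_mkcond.
rewrite [RHS]big_mkcond; apply: eq_bigr => x _.
(* For a fixed increment [x] the inner sum has at most the one term [m' = m * x]. *)
rewrite (eq_bigl (fun m' => (m' == m * x)%g && (X <= content (m * x)%g)%O)).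
  by rewrite big_mkcondr big_pred1_eq le_contentM; do 2!case: (X <= _)%O.
by move=> m' /=; rewrite eq_sym andbC; case: eqVneq => // ->.
Qed.

End Eigenvalues.

(** * Auxiliary facts on measures, hitting times and series *)

Local Open Scope classical_set_scope.

Lemma probability_fibers d (T : measurableType d) (R : realType)
    (mu : probability T R) (I : finType) (f : T -> I) (S : {pred I})
    (A : set T) :
  (forall i, measurable [set w | f w = i]) -> measurable A ->
  mu (A `&` [set w | f w \in S]) =
  (\sum_(i in S) mu (A `&` [set w | f w = i]))%E.
Proof.
move=> mf mA; rewrite -big_enum fsbig_seq ?enum_uniq//=.
rewrite -measure_fin_bigcup//=.
- congr (mu _); apply/seteqP; split => [w [Aw fw]|w [i /=]].
    by exists (f w); rewrite //= mem_enum.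
  by rewrite mem_enum => iS [Aw /= fw]; split => //=; rewrite fw.
- by move=> i j _ _ [w [[_ /= ->] [_ /= ->]]].
- by move=> i _; exact: measurableI.
Qed.

(** A first hitting time counts the [n] up to which, [n] included, no hit has occurred. This is the
    pathwise form of the tail-sum formula. *)
Lemma ereal_inf_hitting_time (R : realType) (a : nat -> bool) :
  ereal_inf [set (n%:R)%:E | n in [set n | a n]] =
  (\sum_(0 <= n <oo) ([forall k : 'I_n.+1, ~~ a k]%:R : R)%:E)%E.
Proof.
case: (pselect (exists n, a n)) => [ex|nex].
  have [N aN minN] := ex_minnP ex.
  (* With [N] the first hit, the terms from index [N] on vanish and the [N] earlier ones equal
     [1]. *)
  rewrite (nneseries_split 0 N)// add0n eseries0 => [|n Nn _]; last first.
    apply/eqP; rewrite eqe; case: forallP => // /(_ (Ordinal (Nn : (N < n.+1)%N))).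
    by rewrite aN.
  rewrite adde0 big_mkord (eq_bigr (fun=> 1%E)) => [|i _]; last first.
    case: forallP => // -[] k; apply/negP => /minN; apply/negP.
    by rewrite -ltnNge (leq_trans (ltn_ord k)).
  rewrite sumEFin sumr_const card_ord; apply/le_anti/andP; split.
    by apply: ereal_inf_lbound; exists N.
  by apply: le_ereal_inf_tmp => _ [n /minN Nn <-]; rewrite lee_fin ler_nat.
rewrite (_ : [set n | a n] = set0) ?image_set0 ?ereal_inf0; last first.
  by rewrite -subset0 => n an; apply: nex; exists n.
(* Without a hit every term is [1], so the partial sums pass any real [r], matching the infimum
   [+oo] of the empty set. *)
apply/esym/eqyP => r r0.
have [N rN] : exists N : nat, r <= N%:R.
  by exists (Num.bound r); exact/ltW/archi_boundP/ltW.
apply: le_trans (nneseries_lim_ge N _) => [|n _ _]; last by rewrite lee_fin.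
rewrite big_mkord (eq_bigr (fun=> 1%E)) => [|i _]; last first.
  by case: forallP => // -[] k; apply/negP => ak; apply: nex; exists k.
by rewrite sumEFin sumr_const card_ord lee_fin.
Qed.

Lemma sum_geometric_series (R : realType) (I : finType) (S : {pred I})
    (c z : I -> R) :
  (forall i, i \in S -> 0 <= z i < 1) ->
  series (fun n => \sum_(i in S) c i * z i ^+ n) @ \oo -->
  \sum_(i in S) c i / (1 - z i).
Proof.
move=> z01.
rewrite (_ : series _ = fun n => \sum_(i in S) series (geometric (c i) (z i)) n).
  apply: cvg_big => [|i /z01/andP[z0 z1]]; first exact: add_continuous.
  by apply: cvg_geometric_series; rewrite ger0_norm.
by apply/funext => n; rewrite /series /= exchange_big.
Qed.

(** * The law of the walk and its absorption *)

Section WalkLaw.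
Context {R : realType} {M : finLRBType} {P : M -> R}
  {d : measure_display} {T : measurableType d} {Pr : probability T R}
  {W : nat -> T -> M}.
Hypotheses (HP : is_probability P) (HW : right_random_walk Pr P W).
Implicit Types (X : Lambda M).

Let pr A := fine (Pr A).

Let prE A : measurable A -> Pr A = (pr A)%:E.
Proof. by move=> mA; rewrite /pr fineK// fin_num_measure. Qed.

Let measurable_at n m : measurable [set w | W n w = m].
Proof. exact: (walk_measurable HW). Qed.
Local Hint Resolve measurable_at : core.

Lemma measurable_walk_in n (S : {pred M}) : measurable [set w | W n w \in S].
Proof.
rewrite (_ : [set _ | _] = \bigcup_(m in [set` S]) [set w | W n w = m]).
  by apply: fin_bigcup_measurable => //; exact: finite_finpred.
by apply/seteqP; split => [w Sw|w [m /= Sm ->//]]; exists (W n w).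
Qed.
Local Hint Resolve measurable_walk_in : core.

Lemma walk_in n (S : {pred M}) :
  Pr [set w | W n w \in S] = (\sum_(m in S) pr [set w | W n w = m])%:E.
Proof.
rewrite -[X in Pr X]setTI probability_fibers// -sumEFin.
by apply: eq_bigr => m _; rewrite setTI prE.
Qed.

(** The lower end [j] interpolates between full histories, [j = 0], and the state at a single time,
    [j = n]. *)
Definition cylinder j n (x : nat -> M) : set T :=
  [set w | forall k, (j <= k <= n)%N -> W k w = x k].

Lemma measurable_cylinder j n x : measurable (cylinder j n x).
Proof.
rewrite (_ : cylinder j n x =
    \bigcap_(k in [set k | (j <= k <= n)%N]) [set w | W k w = x k]).
  exact: bigcap_measurableType.
by [].
Qed.

(** The Markov property survives forgetting the earliest states. Induction on [j]: dropping the
    constraint at time [j] means summing over the value there, and for [j < n] this leaves the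
    transition factor unchanged. *)
Lemma cylinder_step j n x : (j <= n)%N ->
  Pr (cylinder j n.+1 x) =
  (Pr (cylinder j n x) * (transition P (x n) (x n.+1))%:E)%E.
Proof.
elim: j x => [|j IHj] x jn.
  exact: (walk_step HW).
have split_at l : (n <= l)%N -> Pr (cylinder j.+1 l x) =
    (\sum_(m : M) Pr (cylinder j l (fun k => if k == j then m else x k)))%E.
  move=> nl; rewrite -[X in Pr X]setIT.
  rewrite (_ : setT = [set w | W j w \in predT]); last first.
    by apply/seteqP; split.
  rewrite probability_fibers//; last exact: measurable_cylinder.
  apply: eq_bigr => m _; congr (Pr _); apply/seteqP; split => w /=.
    move=> [wx wj] k /andP[jk kl]; case: eqP => [->//|/eqP kj].
    by apply: wx; rewrite kl ltn_neqAle eq_sym kj jk.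
  move=> wx; split=> [k /andP[jk kl]|].
    by rewrite wx ?kl ?(ltnW jk)// gtn_eqF.
  by rewrite wx ?eqxx// leqnn (leq_trans (ltnW jn)).
rewrite !split_at// ge0_sume_distrl//; apply: eq_bigr => m _.
by rewrite IHj ?(ltnW jn)// !gtn_eqF// ltnW.
Qed.

Lemma walk_step2 n a b :
  Pr ([set w | W n w = a] `&` [set w | W n.+1 w = b]) =
  (pr [set w | W n w = a] * transition P a b)%:E.
Proof.
(* Only the values of [x] at [n] and [n.+1] matter here. *)
pose x k := if k == n then a else b.
have xn : x n = a by rewrite /x eqxx.
have xn1 : x n.+1 = b by rewrite /x gtn_eqF.
have := cylinder_step x (leqnn n); rewrite xn xn1.
have -> : cylinder n n x = [set w | W n w = a].
  apply/seteqP; split => w /= wx; first by rewrite wx ?leqnn.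
  by move=> k; rewrite -eqn_leq => /eqP <-; rewrite xn.
rewrite EFinM -prE// => <-.
congr (Pr _); apply/seteqP; split => w /=.
  move=> [wn wn1] k /andP[]; rewrite leq_eqVlt => /predU1P[<- _|nk kn].
    by rewrite xn.
  by rewrite (_ : k = n.+1) ?xn1//; apply/eqP; rewrite eqn_leq kn.
by move=> wx; split; rewrite wx ?leqnn ?leqnSn.
Qed.

Lemma walk_law_step n b :
  pr [set w | W n.+1 w = b] =
  \sum_a pr [set w | W n w = a] * transition P a b.
Proof.
apply: EFin_inj; rewrite -prE// -[X in Pr X]setIT.
rewrite (_ : setT = [set w | W n w \in predT]); last by apply/seteqP; split.
rewrite probability_fibers// -sumEFin.
by apply: eq_bigr => a _; rewrite setIC walk_step2.
Qed.

(** Each step applies the transition matrix to an eigenfunction, which contributes one factor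
    [lambda P X]. *)
Lemma walk_content_ge n X :
  \sum_(m | (X <= content m)%O) pr [set w | W n w = m] = lambda P X ^+ n.
Proof.
elim: n => [|n IHn].
  (* The walk starts at [1] only almost surely, so the probability is squeezed between that of this
     start and [1]. *)
  apply: EFin_inj; rewrite expr0 -walk_in; apply/le_anti/andP; split.
    exact: probability_le1.
  rewrite -(walk_init HW) le_measure ?inE//; last first.
    by move=> w /= ->; exact: le_content1.
under eq_bigr do rewrite walk_law_step.
rewrite exchange_big /= exprS -IHn mulr_sumr [RHS]big_mkcond.
apply: eq_bigr => m _; rewrite -mulr_sumr sum_transition_ge mulrA [LHS]mulrC.
by case: ifP; rewrite ?mulr1// !mulr0.
Qed.

(** Expanding the powers by [walk_content_ge] and exchanging sums, the coefficient of a state [m] is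
    the Moebius sum from the bottom to [content m], which is the indicator of the minimal ideal. *)
Lemma walk_in_minimal_ideal n :
  Pr [set w | W n w \in minimal_ideal M] =
  (\sum_(X : Lambda M) (mobius \bot%O X)%:~R * lambda P X ^+ n)%:E.
Proof.
rewrite walk_in; congr _%:E.
under [RHS]eq_bigr do rewrite -walk_content_ge mulr_sumr.
rewrite (exchange_big_dep xpredT)//= big_mkcond; apply: eq_bigr => m _.
rewrite -mulr_suml -rmorph_sum /=.
rewrite (eq_bigl (fun X => (\bot <= X)%O && (X <= content m)%O)) => [|X]; last first.
  by rewrite le0x.
rewrite sum_mobius_ge ?le0x// mem_minimal_ideal eq_sym.
by case: eqP; rewrite ?mul1r ?mul0r.
Qed.

Lemma walk_notin_minimal_ideal n :
  Pr [set w | W n w \notin minimal_ideal M] =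
  (- \sum_(X : Lambda M | (\bot < X)%O)
       (mobius \bot%O X)%:~R * lambda P X ^+ n)%:E.
Proof.
rewrite (_ : [set _ | _] = ~` [set w | W n w \in minimal_ideal M]); last first.
  by apply/seteqP; split => w /= /negP.
(* The bottom term equals [1], and it cancels the [1] of the complement. *)
rewrite probability_setC// walk_in_minimal_ideal (bigD1 \bot%O)//=.
rewrite mobiusxx lambda_bot// expr1n mulr1 -EFinB opprD addrA subrr add0r.
by under eq_bigl do rewrite -lt0x.
Qed.

(** The event is null rather than empty: the hypotheses on [W] constrain its law, not every
    trajectory. *)
Lemma walk_exit_minimal_ideal n :
  Pr ([set w | W n w \in minimal_ideal M] `&`
      [set w | W n.+1 w \notin minimal_ideal M]) = 0%E.
Proof.
rewrite (probability_fibers _ [predC minimal_ideal M])//; apply: big1 => b bI.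
rewrite setIC probability_fibers//; apply: big1 => a aI.
by rewrite setIC walk_step2 transition_minimal_ideal// mulr0.
Qed.

(** This is the event that [absorption_time W] exceeds [n]. *)
Definition survival n : set T :=
  [set w | [forall k : 'I_n.+1, W k w \notin minimal_ideal M]].

Lemma measurable_survival n : measurable (survival n).
Proof.
rewrite (_ : survival n =
    \bigcap_(k : 'I_n.+1) [set w | W k w \in [predC minimal_ideal M]]).
  apply: fin_bigcap_measurable => // i _.
  exact: (measurable_walk_in i [predC minimal_ideal M]).
by apply/seteqP; split => w => [/forallP wI k _|wI];
  [exact: wI|apply/forallP => k; exact: wI].
Qed.
Local Hint Resolve measurable_survival : core.

(* Being outside the minimal ideal at time [n] differs from having avoided it
   up to time [n] by an exit from the ideal, which is a null event. *)
Lemma survivalE n :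
  Pr (survival n) = Pr [set w | W n w \notin minimal_ideal M].
Proof.
have mI k : measurable [set w | W k w \notin minimal_ideal M].
  exact: (measurable_walk_in k [predC minimal_ideal M]).
have late0 : Pr ([set w | W n w \notin minimal_ideal M] `\` survival n) = 0%E.
  elim: n => [|n IHn].
    rewrite (_ : _ `\` _ = set0) ?measure0// -subset0 => w [/= w0]; apply.
    by apply/forallP => k; rewrite ord1.
  have mE : measurable ([set w | W n w \in minimal_ideal M] `&`
      [set w | W n.+1 w \notin minimal_ideal M]) by exact: measurableI.
  have mD k : measurable ([set w | W k w \notin minimal_ideal M] `\` survival k).
    exact: measurableD.
  (* A late return outside the ideal at time [n.+1] is either an exit at that very step or already a
     late return at time [n]. *)
  apply: (subset_measure0 (mD _) (measurableU _ _ mE (mD n))); last first.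
    exact: (null_set_setU mE (mD n) (walk_exit_minimal_ideal n) IHn).
  move=> w [/= wI wS]; case: (boolP (W n w \in minimal_ideal M)) => wn.
    by left.
  right; split=> // /forallP wSn; apply: wS; apply/forallP => k.
  have [->//|kn] := eqVneq (k : nat) n.+1.
  have kn' : (k < n.+1)%N by rewrite ltn_neqAle kn -ltnS ltn_ord.
  exact: (wSn (Ordinal kn')).
rewrite [RHS](measureDI _ (mI n) (measurable_survival n)) [X in (X + _)%E]late0.
rewrite add0e; congr (Pr _); apply/esym/setIidr => w /forallP wS.
exact: (wS ord_max).
Qed.

(** Pathwise, the absorption time is the sum of the indicators of the survival events; these are
    nonnegative, so integral and series commute. *)
Lemma integral_absorption_time :
  (\int[Pr]_w absorption_time W w)%E = (\sum_(0 <= n <oo) Pr (survival n))%E.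
Proof.
transitivity (\int[Pr]_w \sum_(0 <= n <oo) (\1_(survival n) w : R)%:E)%E.
  apply: eq_integral => w _; rewrite /absorption_time ereal_inf_hitting_time.
  apply: eq_eseriesr => n _; rewrite indicE; congr ((nat_of_bool _)%:R)%:E.
  by apply/idP/idP; rewrite inE.
rewrite integral_nneseries//.
- by apply: eq_eseriesr => n _; rewrite integral_indic// setIT.
- by move=> n; apply/measurable_EFinP; exact: measurable_indic.
Qed.

End WalkLaw.

(** * Summation of the geometric series *)

Theorem theorem4p16 (R : realType) (M : finLRBType) (P : M -> R)
    (HP : is_probability P) (HPa : adapted P)
    (d : measure_display) (T : measurableType d) (Pr : probability T R)
    (W : nat -> T -> M) (HW : right_random_walk Pr P W) :
  (\int[Pr]_w absorption_time W w)%E =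
  (- \sum_(X : Lambda M | (\bot < X)%O)
       (1 / (1 - lambda P X)) * (mobius \bot%O X)%:~R)%:E.
Proof.
rewrite (integral_absorption_time HW).
under eq_eseriesr do rewrite (survivalE HW) (walk_notin_minimal_ideal HP HW).
(* The sign goes into the coefficients, to match the form of [sum_geometric_series]. *)
pose c (X : Lambda M) : R := - (mobius \bot%O X)%:~R.
rewrite (_ : - _ = \sum_(X : Lambda M | (\bot < X)%O) c X / (1 - lambda P X)); last first.
  rewrite -sumrN; apply: eq_bigr => X _.
  by rewrite mul1r mulNr mulrC.
apply/cvg_lim => //.
pose S := [pred X : Lambda M | (\bot < X)%O].
pose u n := \sum_(X in S) c X * lambda P X ^+ n.
(* The partial sums are real, so the limit can be taken in [R] and carried over to the extended
   reals. *)
rewrite (_ : (fun _ => _) = EFin \o series u); last first.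
  apply/funext => n; rewrite /= sumEFin /series /u /=; congr _%:E.
  apply: eq_bigr => k _; rewrite -sumrN; apply: eq_bigr => X _.
  by rewrite mulNr.
apply: cvg_EFin; first exact: nearW.
by apply: sum_geometric_series => X X0; rewrite lambda_ge0// lambda_lt1.
Qed.
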